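(* Let $n\ge3$, $m=\lfloor n/2\rfloor$ and $\rho\in\mathrm{Par}_m$. Then $\mathrm{SST}_n^{\mathrm{AI}}(\rho)$ is an $\mathrm{AI}$-subcrystal of $\mathrm{SST}_n(\rho)$; that is, for every $T\in\mathrm{SST}_n^{\mathrm{AI}}(\rho)$ and $i\in\{1,\dots,n-1\}$, one has $\widetilde B_iT\in\mathrm{SST}_n^{\mathrm{AI}}(\rho)\sqcup\{0\}$.
   Context: $\mathrm{Par}_l$ is the set of partitions of length $\le l$. $\mathrm{SST}_n(\lambda)$ is the set of semistandard Young tableaux of shape $\lambda$ with entries in $\{1,\dots,n\}$; $d_j$ is the length of the $j$-th column of the diagram. For $\rho\in\mathrm{Par}_m$, $\mathrm{SST}_n^{\mathrm{AI}}(\rho)$ is the set of $T\in\mathrm{SST}_n(\rho)$ (entries $t_{i,j}$) with $t^c_{i,1}\le t_{i,2}$ for all $1\le i\le d_2$, where $t^c_{1,1}<\dots<t^c_{n-d_1,1}$ are the elements of $\{1,\dots,n\}\setminus\{t_{1,1},\dots,t_{d_1,1}\}$. The column reading $\mathrm{CR}(T)$ reads the columns left to right, each from bottom to top. For $i\in\{1,\dots,n-1\}$ and a word $w$, keep only letters $i,i+1$ and successively delete adjacent pairs $(i+1),i$ (an $i+1$ immediately left of an $i$ among the remaining letters) until $i^{a}(i+1)^{b}$ is left; $\varphi_i(w)=a$, $\varepsilon_i(w)=b$; $\widetilde F_i w$ changes the rightmost undeleted $i$ into $i+1$ ($0$ if $a=0$), $\widetilde E_iw$ changes the leftmost undeleted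 $i+1$ into $i$ ($0$ if $b=0$). For $T\in\mathrm{SST}_n(\lambda)$, $\varphi_i,\varepsilon_i$ are those of $\mathrm{CR}(T)$, and $\widetilde E_iT,\widetilde F_iT\in\mathrm{SST}_n(\lambda)\sqcup\{0\}$ are the tableaux of shape $\lambda$ (or $0$) with column readings $\widetilde E_i\mathrm{CR}(T),\widetilde F_i\mathrm{CR}(T)$. The $\mathrm{AI}$-crystal structure on $\mathrm{SST}_n(\lambda)$ is: $\deg_i(T)=\varepsilon_i(T)$, $\widetilde B_iT=\widetilde E_iT$ if $\varphi_i(T)$ is even; $\deg_i(T)=\varepsilon_i(T)+1$, $\widetilde B_iT=\widetilde F_iT$ if $\varphi_i(T)$ is odd. *)

(* Defs.v *)
From mathcomp Require Import all_boot.

Set Implicit Arguments.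
Unset Strict Implicit.
Unset Printing Implicit Defensive.

(* Partitions are listed without zero parts, so that the length is the size. *)
Definition Par (l : nat) : pred (seq nat) :=
  [pred lam | [&& sorted geq lam, 0 \notin lam & size lam <= l]].

(* The sequence of column lengths d_1, d_2, ... of the diagram of lam. *)
Definition col_lengths (lam : seq nat) : seq nat :=
  [seq count (fun r => j < r) lam | j <- iota 0 (head 0 lam)].

(* A filling is the list of its columns, left to right, each column being
   listed from top to bottom.  Letters are the natural numbers 1, ..., n;
   rows and columns are indexed from 0. *)
Definition filling := seq (seq nat).

(* Adjacent columns: entrywise <= on the rows that meet the right column. *)
Definition col_le (C D : seq nat) : bool :=
  all (fun k => nth 0 C k <= nth 0 D k) (iota 0 (size D)).

Definition SST (n : nat) (lam : seq nat) : pred filling :=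
  [pred T : filling |
    [&& shape T == col_lengths lam,
        all (all (fun x => 1 <= x <= n)) T,
        all (sorted ltn) T
      & sorted col_le T]].

(* The letters missing from the first column, in increasing order. *)
Definition compl_col1 (n : nat) (T : filling) : seq nat :=
  [seq x <- iota 1 n | x \notin nth [::] T 0].

Definition SST_AI (n : nat) (rho : seq nat) : pred filling :=
  [pred T : filling |
    (T \in SST n rho) &&
    all (fun k => nth 0 (compl_col1 n T) k <= nth 0 (nth [::] T 1) k)
        (iota 0 (nth 0 (col_lengths rho) 1))].

Definition col_reading (T : filling) : seq nat := flatten [seq rev C | C <- T].

(* The inverse of the column reading, for given column lengths sh. *)
Definition of_col_reading (sh w : seq nat) : filling :=
  [seq rev C | C <- reshape sh w].

Lemma shape_of_col_reading (sh w : seq nat) :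
  size w = sumn sh -> shape (of_col_reading sh w) = sh.
Proof.
move=> sz; rewrite /shape /of_col_reading -map_comp.
rewrite (eq_map (g := size)) => [|C /=]; last by rewrite size_rev.
by apply: reshapeKl; rewrite sz.
Qed.

Lemma of_col_readingK (sh w : seq nat) :
  size w = sumn sh -> col_reading (of_col_reading sh w) = w.
Proof.
move=> sz; rewrite /col_reading /of_col_reading (mapK revK).
by apply: reshapeKr; rewrite sz.
Qed.

Lemma col_readingK (T : filling) :
  of_col_reading (shape T) (col_reading T) = T.
Proof.
rewrite /of_col_reading /col_reading.
have -> : shape T = shape [seq rev C | C <- T].
  by rewrite /shape -map_comp; apply: eq_map => C /=; rewrite size_rev.
by rewrite flattenK (mapK revK).
Qed.

(* Undeleted letters of w are represented by their positions in w.  One step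
   deletes the first adjacent pair (i+1), i, if there is one. *)
Fixpoint delete_pair (i : nat) (w s : seq nat) : seq nat :=
  if s is p :: s' then
    if s' is q :: s'' then
      if (nth 0 w p == i.+1) && (nth 0 w q == i) then s''
      else p :: delete_pair i w s'
    else s
  else s.

(* size w steps are enough to reach a list without such a pair. *)
Definition undeleted (i : nat) (w : seq nat) : seq nat :=
  iter (size w) (delete_pair i w)
    [seq p <- iota 0 (size w) | (nth 0 w p == i) || (nth 0 w p == i.+1)].

Definition undeleted_at (i x : nat) (w : seq nat) : seq nat :=
  [seq p <- undeleted i w | nth 0 w p == x].

Definition phi (i : nat) (w : seq nat) : nat := size (undeleted_at i i w).
Definition eps (i : nat) (w : seq nat) : nat := size (undeleted_at i i.+1 w).

(* The formal symbol 0 is None. *)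
Definition Fword (i : nat) (w : seq nat) : option (seq nat) :=
  if phi i w == 0 then None
  else Some (set_nth 0 w (last 0 (undeleted_at i i w)) i.+1).

Definition Eword (i : nat) (w : seq nat) : option (seq nat) :=
  if eps i w == 0 then None
  else Some (set_nth 0 w (head 0 (undeleted_at i i.+1 w)) i).

Definition Ftilde (i : nat) (T : filling) : option filling :=
  omap (of_col_reading (shape T)) (Fword i (col_reading T)).

Definition Etilde (i : nat) (T : filling) : option filling :=
  omap (of_col_reading (shape T)) (Eword i (col_reading T)).

Definition deg (i : nat) (T : filling) : nat :=
  if odd (phi i (col_reading T)) then (eps i (col_reading T)).+1
  else eps i (col_reading T).

Definition Btilde (i : nat) (T : filling) : option filling :=
  if odd (phi i (col_reading T)) then Ftilde i T else Etilde i T.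

(* The degree functions of a subcrystal are restrictions of deg, so they
   impose no condition. *)
Definition AI_subcrystal (n : nat) (lam : seq nat) (S : pred filling) : Prop :=
  {subset S <= SST n lam} /\
  forall (T : filling) (i : nat), T \in S -> 1 <= i <= n.-1 ->
    forall T' : filling, Btilde i T = Some T' -> T' \in S.

Lemma undeleted_normal (i : nat) (w : seq nat) :
  [seq nth 0 w p | p <- undeleted i w] = nseq (phi i w) i ++ nseq (eps i w) i.+1.
Proof.
pose two := all (fun p => (nth 0 w p == i) || (nth 0 w p == i.+1)).
have delE p q s : delete_pair i w [:: p, q & s] =
    if (nth 0 w p == i.+1) && (nth 0 w q == i) then s
    else p :: delete_pair i w (q :: s) by [].
have two_del s : two s -> two (delete_pair i w s).
  rewrite /two; elim: s => [|p [|q s] IH] // /andP[hp hqs].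
  rewrite delE; case: ifP => _; first by case/andP: hqs.
  by apply/andP; split=> //; apply: IH.
have del_fix s : delete_pair i w s = s \/ size (delete_pair i w s) < size s.
  elim: s => [|p [|q s] IH]; [by left | by left |].
  rewrite delE; case: ifP => _; first by right; apply: leqnSn.
  by case: IH => [->|lt]; [left | right].
have iter_fix k s : size s <= k ->
    delete_pair i w (iter k (delete_pair i w) s) = iter k (delete_pair i w) s.
  elim: k s => [|k IH] s; first by case: s.
  rewrite iterSr => sz; case: (del_fix s) => [e|lt].
    by rewrite e; elim: {IH sz} k => [|k IHk] //=; rewrite !IHk.
  by apply: IH; rewrite -ltnS (leq_trans lt).
have two_iter k s : two s -> two (iter k (delete_pair i w) s).
  by elim: k => //= k IH /IH /two_del.
have norm s : two s -> delete_pair i w s = s ->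
    [seq nth 0 w p | p <- s] =
    nseq (count (fun p => nth 0 w p == i) s) i ++
    nseq (count (fun p => nth 0 w p == i.+1) s) i.+1.
  rewrite /two; elim: s => [|p s IH] // /andP[hp hs].
  case: s IH hs => [|q s] IH hs.
    by move=> _ /=; case/orP: hp => /eqP->;
      rewrite eqxx ?(gtn_eqF (ltnSn i)) ?(ltn_eqF (ltnSn i)).
  rewrite delE; case: ifP => pq.
    by move/(congr1 size) => /= e; have := leqnSn (size s).+1; rewrite -e ltnn.
  case=> e; move: (IH hs e) => {IH e}.
  have : nth 0 w p = i.+1 -> nth 0 w q = i.+1.
    by move=> ep; move: pq hs; rewrite ep eqxx /= => -> /= /andP[/eqP].
  have : nth 0 w q = head 0 [seq nth 0 w p | p <- q :: s] by [].
  move: (q :: s) => t -> eq_q IH; rewrite [LHS]/= IH.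
  move: eq_q; rewrite IH => eq_q /=.
  case/orP: hp => /eqP ep; rewrite ep eqxx ?(ltn_eqF (ltnSn i)) //.
  move: (eq_q ep); rewrite (gtn_eqF (ltnSn i)) add0n.
  by case: (count _ t) => [|c] //= /eqP; rewrite (ltn_eqF (ltnSn i)).
rewrite /phi /eps /undeleted_at !size_filter; apply: norm.
  by apply: two_iter; apply: filter_all.
apply: iter_fix; rewrite size_filter.
by apply: leq_trans (count_size _ _) _; rewrite size_iota.
Qed.

(* Main.v *)
Require Import Defs.
From mathcomp Require Import all_boot zify.

(* The letter changed by F_i or E_i sits where the prefix weight #i - #(i+1) of
   the word peaks: every word just before it has at least as many i as i+1, and
   every word just after it has at most as many.  Applied to the neighbouring
   columns, this keeps the tableau semistandard: an obstructing neighbour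
   would violate one of these inequalities.
   The AI condition says that the complement of the first column could stand
   to the left of the second one, and the complement of a column has opposite
   weight.  Changing the first column is thus governed by the same inequalities;
   F_i on the second column is harmless, and E_i on the second column could only
   fail if phi_i = 1, where B_i is F_i. *)

Set Implicit Arguments.
Unset Strict Implicit.
Unset Printing Implicit Defensive.

(** * Prefix weights of a word and of its undeleted letters *)

Lemma delete_pairP (i : nat) (w s : seq nat) :
  delete_pair i w s = s \/
  exists s1 p q s2, [/\ s = s1 ++ [:: p, q & s2], nth 0 w p = i.+1,
    nth 0 w q = i & delete_pair i w s = s1 ++ s2].
Proof.
elim: s => [|p [|q s] IH]; [by left | by left |].
have -> : delete_pair i w [:: p, q & s] =
    if (nth 0 w p == i.+1) && (nth 0 w q == i) then s
    else p :: delete_pair i w (q :: s) by [].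
case: ifP => [/andP[/eqP ep /eqP eq]|_]; first by right; exists [::], p, q, s.
case: IH => [->|[s1 [p' [q' [s2 [-> ep eq ->]]]]]]; first by left.
by right; exists (p :: s1), p', q', s2.
Qed.

Definition count_below (w s : seq nat) (x k : nat) : nat :=
  count (fun r => (r < k) && (nth 0 w r == x)) s.

(* Deleting an adjacent pair p < q changes the weight #i - #(i+1) of the
   listed positions below k only for p < k <= q, where it increases it. *)
Definition dominates (i : nat) (w s : seq nat) : Prop :=
  [/\ sorted ltn s, {in s, forall r, r < size w},
      forall k, count_mem i (take k w) + count_below w s i.+1 k
             <= count_below w s i k + count_mem i.+1 (take k w)
    & {in s, forall r k, r <= k <= r.+1 ->
        count_mem i (take k w) + count_below w s i.+1 k
        = count_below w s i k + count_mem i.+1 (take k w)}].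

Lemma count_take_below (w : seq nat) (x k : nat) :
  count_mem x (take k w) = count_below w (iota 0 (size w)) x k.
Proof.
rewrite /count_below -{1}(mkseq_nth 0 w) /mkseq -map_take take_iota count_map.
have [le_k|lt_k] := leqP k (size w).
  have -> : size w = k + (size w - k) by rewrite subnKC.
  rewrite iotaD count_cat [X in _ + X](@eq_in_count _ _ pred0).
    rewrite count_pred0 addn0; apply: eq_in_count => r.
    by rewrite mem_iota /= => ->.
  by move=> r; rewrite mem_iota => /andP[h _]; rewrite ltnNge h.
by apply: eq_in_count => r; rewrite mem_iota /= => h; rewrite (ltn_trans h).
Qed.

Lemma count_below_filter (w s : seq nat) (a : pred nat) (x k : nat) :
  (forall r, nth 0 w r == x -> a r) ->
  count_below w (filter a s) x k = count_below w s x k.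
Proof.
move=> ax; rewrite /count_below count_filter; apply: eq_count => r /=.
by case: (boolP (nth 0 w r == x)) => [/ax ->|_]; rewrite ?andbT ?andbF.
Qed.

Lemma dominates_delete_pair (i : nat) (w s : seq nat) :
  dominates i w s -> dominates i w (delete_pair i w s).
Proof.
case: (delete_pairP i w s) => [->|[s1 [p [q [s2 [-> ep eq ->]]]]]] //.
case=> srt lt_s le_s eq_s.
have sub r : r \in s1 ++ s2 -> r \in s1 ++ [:: p, q & s2].
  by rewrite !mem_cat !inE => /orP[->|->]; rewrite ?orbT.
have cE x k : count_below w (s1 ++ [:: p, q & s2]) x k =
   ((p < k) && (i.+1 == x)) + ((q < k) && (i == x)) + count_below w (s1 ++ s2) x k.
  by rewrite /count_below !count_cat /= ep eq; lia.
move: (srt); rewrite (sorted_pairwise ltn_trans) pairwise_cat allrel_consr.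
rewrite allrel_consr /= => /andP[/and3P[lt1p lt1q lt12]
  /and4P[p1 /andP[lt_pq lt_p2] lt_q2 p2]].
(* The positions [p] and [q] are adjacent in an increasing list, so a surviving [r] lies left of
   both or right of both. A cut at [r] or just after it does not separate the pair, and the equality
   at [r] survives the deletion. *)
have out r : r \in s1 ++ s2 -> r < p \/ q < r.
  by rewrite mem_cat => /orP[/(allP lt1p)|/(allP lt_q2)]; [left|right].
split.
- by rewrite (sorted_pairwise ltn_trans) pairwise_cat lt12 p1 p2.
- by move=> r /sub/lt_s.
- move=> k; move: (le_s k); rewrite !cE !eqxx (gtn_eqF (ltnSn i)) (ltn_eqF (ltnSn i)).
  rewrite !andbT !andbF; lia.
- move=> r rs k rk; move: (eq_s r (sub r rs) k rk) (out r rs).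
  rewrite !cE !eqxx (gtn_eqF (ltnSn i)) (ltn_eqF (ltnSn i)) !andbT !andbF; lia.
Qed.

(** The initial list holds every occurrence of [i] and [i.+1], so at the start all the inequalities
    are equalities. *)
Lemma dominates_undeleted (i : nat) (w : seq nat) : dominates i w (undeleted i w).
Proof.
rewrite /undeleted; elim: {1}(size w) => [|k IH]; last exact: dominates_delete_pair.
have cE x k : (x == i) || (x == i.+1) ->
    count_below w [seq p <- iota 0 (size w) | (nth 0 w p == i) || (nth 0 w p == i.+1)] x k
    = count_mem x (take k w).
  by move=> hx; rewrite count_below_filter ?count_take_below // => r /eqP->.
split=> [|r|k|r _ k _] /=.
- by apply: sorted_filter; [exact: ltn_trans | exact: iota_ltn_sorted].
- by rewrite mem_filter mem_iota => /andP[_].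
- by rewrite !cE ?eqxx ?orbT.
- by rewrite !cE ?eqxx ?orbT.
Qed.

Lemma undeleted_split (i : nat) (w : seq nat) :
  undeleted i w = undeleted_at i i w ++ undeleted_at i i.+1 w.
Proof.
move: (undeleted_normal i w); rewrite /phi /eps /undeleted_at.
set U := undeleted i w; set a := size _; set b := size _ => e.
have sz : size U = a + b by rewrite -(size_map (nth 0 w)) e size_cat !size_nseq.
have eT : [seq nth 0 w p | p <- take a U] = nseq a i.
  by rewrite map_take e take_size_cat ?size_nseq.
have eD : [seq nth 0 w p | p <- drop a U] = nseq b i.+1.
  by rewrite map_drop e drop_size_cat ?size_nseq.
have inT r : r \in take a U -> nth 0 w r = i.
  by move/(map_f (nth 0 w)); rewrite eT mem_nseq => /andP[_ /eqP].
have inD r : r \in drop a U -> nth 0 w r = i.+1.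
  by move/(map_f (nth 0 w)); rewrite eD mem_nseq => /andP[_ /eqP].
rewrite -{1 2 3}(cat_take_drop a U) !filter_cat.
rewrite (@eq_in_filter _ _ predT (take a U)) ?filter_predT; last first.
  by move=> r /inT ->; rewrite eqxx.
rewrite (@eq_in_filter _ _ pred0 (drop a U)) ?filter_pred0 ?cats0; last first.
  by move=> r /inD ->; rewrite (gtn_eqF (ltnSn i)).
rewrite (@eq_in_filter _ _ pred0 (take a U)) ?filter_pred0; last first.
  by move=> r /inT ->; rewrite (ltn_eqF (ltnSn i)).
rewrite (@eq_in_filter _ _ predT (drop a U)) ?filter_predT //.
by move=> r /inD ->; rewrite eqxx.
Qed.

(* Equivalently, the prefix weight #i - #(i+1) of u ++ x :: v is, among the
   prefixes of u, largest at u, and among those longer than u, largest at u ++ [:: x]. *)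
Definition balanced_at (i : nat) (u v : seq nat) : Prop :=
  (forall u1 u2, u = u1 ++ u2 -> count_mem i.+1 u2 <= count_mem i u2) /\
  (forall v1 v2, v = v1 ++ v2 -> count_mem i v1 <= count_mem i.+1 v1).

(** The prefix weight of the word is bounded by that of the undeleted positions, with equality at
    [p] and [p.+1]. The latter weight is at most [size s1] up to [p], where it equals [size s1], and
    it can only decrease after [p.+1], since [s2] carries only letters [i.+1]. So the word inherits
    both maxima. *)
Lemma undeleted_balanced (i p : nat) (w s1 s2 : seq nat) :
  undeleted i w = s1 ++ p :: s2 ->
  {in s1, forall r, nth 0 w r = i} -> {in s2, forall r, nth 0 w r = i.+1} ->
  [/\ p < size w, balanced_at i (take p w) (drop p.+1 w)
    & size s1 + count_mem i.+1 (take p w) = count_mem i (take p w)].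
Proof.
move=> eU in1 in2; case: (dominates_undeleted i w); rewrite eU => srt lt_s le_s eq_s.
have ps : p \in s1 ++ p :: s2 by rewrite mem_cat inE eqxx orbT.
have lt_p := lt_s p ps.
have Ep := eq_s p ps p; rewrite leqnn leqnSn in Ep.
have EpS := eq_s p ps p.+1; rewrite leqnn leqnSn in EpS.
move: srt; rewrite (sorted_pairwise ltn_trans) pairwise_cat allrel_consr /=.
case/andP=> /andP[lt1p _] /andP[_ /andP[lt_p2 _]].
have c1S k : count_below w s1 i.+1 k = 0.
  rewrite -(count_pred0 s1); apply: eq_in_count => r /in1 -> /=.
  by rewrite (ltn_eqF (ltnSn i)) andbF.
have c1k k : p <= k -> count_below w s1 i k = size s1.
  move=> pk; rewrite -(count_predT s1); apply: eq_in_count => r rs.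
  by rewrite (leq_trans (allP lt1p r rs) pk) in1 // eqxx.
have c2 k : count_below w s2 i k = 0.
  rewrite -(count_pred0 s2); apply: eq_in_count => r /in2 -> /=.
  by rewrite (gtn_eqF (ltnSn i)) andbF.
have c2k k : k <= p.+1 -> count_below w s2 i.+1 k = 0.
  move=> kp; rewrite -(count_pred0 s2); apply: eq_in_count => r /(allP lt_p2) pr.
  by rewrite ltnNge (leq_trans kp pr).
have cE x k : count_below w (s1 ++ p :: s2) x k =
    count_below w s1 x k + ((p < k) && (nth 0 w p == x)) + count_below w s2 x k.
  by rewrite /count_below count_cat /= addnA.
have c1i k : count_below w s1 i k <= size s1 by apply: count_size.
have {}Ep := Ep isT; have {}EpS := EpS isT.
rewrite !cE !c1S !c2 !c2k // ?c1k // ltnn ltnSn /= ?addn0 ?add0n in Ep EpS.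
split=> //.
split=> [u1 u2 eu|v1 v2 ev].
  have le_k : size u1 <= p.
    by have := congr1 size eu; rewrite size_takel ?(ltnW lt_p) // size_cat; lia.
  have := le_s (size u1).
  rewrite !cE !c1S !c2 c2k ?(leq_trans le_k) // (ltnNge p) le_k /= !addn0.
  have -> : take (size u1) w = u1.
    by rewrite -(cat_take_drop p w) eu -catA take_size_cat.
  move: Ep; rewrite eu !count_cat; have := c1i (size u1); lia.
have := le_s (p.+1 + size v1); rewrite !cE !c1S !c2 c1k ?addSn ?ltnS ?leq_addr; last lia.
have -> : take (p + size v1).+1 w = take p.+1 w ++ v1.
  by rewrite -addSn takeD ev take_size_cat.
rewrite !count_cat /=; move: EpS; lia.
Qed.

(** * The letter changed by [Fword] or [Eword], in the word and in the tableau *)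

Lemma set_nth_split (w : seq nat) (p y : nat) : p < size w ->
  set_nth 0 w p y = take p w ++ y :: drop p.+1 w.
Proof. by move=> lt_p; rewrite set_nthE lt_p. Qed.

Lemma mem_undeleted_at (i x : nat) (w : seq nat) :
  {in undeleted_at i x w, forall r, nth 0 w r = x}.
Proof. by move=> r; rewrite mem_filter => /andP[/eqP]. Qed.

Lemma FwordP (i : nat) (w w' : seq nat) : Fword i w = Some w' ->
  exists u v, [/\ w = u ++ i :: v, w' = u ++ i.+1 :: v & balanced_at i u v].
Proof.
rewrite /Fword /phi; case: eqP => // /eqP ne [<-] {w'}.
have := undeleted_split i w; have := @mem_undeleted_at i i w.
case/lastP: (undeleted_at i i w) ne => [|s1 p] // _ in1.
rewrite last_rcons cat_rcons => eU.
have [|lt_p bal _] := undeleted_balanced eU _ (@mem_undeleted_at i i.+1 w).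
  by move=> r rs; apply: in1; rewrite mem_rcons inE rs orbT.
exists (take p w), (drop p.+1 w); rewrite set_nth_split //; split=> //.
by rewrite -[in RHS](in1 p) ?mem_rcons ?mem_head // -drop_nth // cat_take_drop.
Qed.

(** Here the position is the first undeleted [i.+1], so all undeleted [i] lie before it and the
    weight of [u] is exactly [phi]. This value is what later brings in the parity of [phi]. *)
Lemma EwordP (i : nat) (w w' : seq nat) : Eword i w = Some w' ->
  exists u v, [/\ w = u ++ i.+1 :: v, w' = u ++ i :: v, balanced_at i u v
    & phi i w + count_mem i.+1 u = count_mem i u].
Proof.
rewrite /Eword /eps; case: eqP => // /eqP ne [<-] {w'}.
have := undeleted_split i w; have := @mem_undeleted_at i i.+1 w.
case: (undeleted_at i i.+1 w) ne => [|p s2] // _ in2 /= eU.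
have [|lt_p bal ephi] := undeleted_balanced eU (@mem_undeleted_at i i w).
  by move=> r rs; apply: in2; rewrite inE rs orbT.
exists (take p w), (drop p.+1 w); rewrite set_nth_split //; split=> //.
by rewrite -[in RHS](in2 p) ?mem_head // -drop_nth // cat_take_drop.
Qed.

(** Columns are read from bottom to top: the letters [C2] below [x] are read just before it, and the
    letters [C1] above [x] just after it. *)
Lemma col_reading_split (T : filling) (u v : seq nat) (x : nat) :
  col_reading T = u ++ x :: v ->
  exists T1 C1 C2 T2, [/\ T = T1 ++ (C1 ++ x :: C2) :: T2,
    u = col_reading T1 ++ rev C2, v = rev C1 ++ col_reading T2
    & forall y, of_col_reading (shape T) (u ++ y :: v) = T1 ++ (C1 ++ y :: C2) :: T2].
Proof.
move=> e; suff [T1 [C1 [C2 [T2 [eT eu ev]]]]] : exists T1 C1 C2 T2,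
    [/\ T = T1 ++ (C1 ++ x :: C2) :: T2, u = col_reading T1 ++ rev C2
      & v = rev C1 ++ col_reading T2].
  exists T1, C1, C2, T2; split=> // y.
  rewrite -[RHS]col_readingK; congr of_col_reading.
    by rewrite eT /shape !map_cat /= !size_cat.
  by rewrite eu ev /col_reading map_cat flatten_cat /= rev_cat rev_cons cat_rcons -!catA.
elim: T u e => [|C T IH] u; first by case: u.
rewrite /col_reading /= -/(col_reading T) => e.
have [lt_u|ge_u] := ltnP (size u) (size (rev C)).
  have := congr1 (take (size u)) e; have := congr1 (drop (size u)) e.
  rewrite !drop_cat !take_cat lt_u ltnn subnn take0 drop0 cats0.
  rewrite (drop_nth 0 lt_u) /= => -[ex ev] eu.
  exists [::], (rev (drop (size u).+1 (rev C))), (rev u), T.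
  rewrite !revK ev; split=> //=; congr (_ :: _); apply: (can_inj revK).
  by rewrite rev_cat rev_cons !revK cat_rcons -ex -{1}eu -drop_nth // cat_take_drop.
have := congr1 (take (size (rev C))) e; have := congr1 (drop (size (rev C))) e.
rewrite !drop_cat !take_cat ltnn subnn take0 drop0 cats0.
(* If [u] is exactly the reading of [C], then [x] is read first in what remains, so the induction
   hypothesis is used with an empty prefix. *)
move: ge_u; rewrite leq_eqVlt => /orP[/eqP ge_u|gt_u].
  rewrite ge_u ltnn subnn take0 drop0 cats0 => eT eC.
  have [T1 [C1 [C2 [T2 [-> eu ->]]]]] := IH [::] eT.
  exists (C :: T1), C1, C2, T2; split=> //=.
  by rewrite /col_reading /= -/(col_reading T1) -catA -eu cats0 eC.
rewrite gt_u => eT eC; have [T1 [C1 [C2 [T2 [-> eu ->]]]]] := IH _ eT.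
exists (C :: T1), C1, C2, T2; split=> //=.
by rewrite /col_reading /= -/(col_reading T1) -catA -eu {1}eC cat_take_drop.
Qed.

(** * Comparing adjacent columns after changing one letter *)

Lemma col_leP (C D : seq nat) :
  reflect (forall k, k < size D -> nth 0 C k <= nth 0 D k) (col_le C D).
Proof.
apply: (iffP allP) => h k; last by rewrite mem_iota; apply: h.
by move=> lt_k; apply: h; rewrite mem_iota.
Qed.

Lemma nth_replace (C1 C2 : seq nat) (x y k : nat) :
  nth 0 (C1 ++ y :: C2) k = if k == size C1 then y else nth 0 (C1 ++ x :: C2) k.
Proof.
rewrite !nth_cat; case: ltngtP => // [h|->]; last by rewrite subnn.
by rewrite -(subnSK h).
Qed.

Lemma col_le_decr_l (x y : nat) (C1 C2 D : seq nat) : y <= x ->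
  col_le (C1 ++ x :: C2) D -> col_le (C1 ++ y :: C2) D.
Proof.
move=> yx /col_leP le_CD; apply/col_leP => k /le_CD.
rewrite (nth_replace _ _ x y); case: eqP => // ->.
by rewrite nth_cat ltnn subnn /=; apply: leq_trans.
Qed.

Lemma col_le_incr_r (x y : nat) (A D1 D2 : seq nat) : x <= y ->
  col_le A (D1 ++ x :: D2) -> col_le A (D1 ++ y :: D2).
Proof.
move=> xy /col_leP le_AD; apply/col_leP => k.
have -> : size (D1 ++ y :: D2) = size (D1 ++ x :: D2) by rewrite !size_cat.
move/le_AD; rewrite (nth_replace _ _ x y); case: eqP => // ->.
by rewrite nth_cat ltnn subnn /= => /leq_trans; apply.
Qed.

Lemma sorted_nth_lt (s : seq nat) (j k : nat) :
  sorted ltn s -> j < size s -> k < size s -> (nth 0 s j < nth 0 s k) = (j < k).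
Proof.
move=> srt js ks; have mono := sorted_ltn_nth ltn_trans 0 srt.
case: (ltngtP j k) => [jk|kj|->]; last by rewrite ltnn.
  exact: mono.
by have := mono k j ks js kj => /= h; rewrite ltnNge (ltnW h).
Qed.

(** Only a row with [i] in both columns can obstruct. Then [D] has [i.+1] in a lower row, where the
    entry of [C] is at most [i.+1] and not equal to it, hence at most [i]; this contradicts
    strictness of [C]. The bound on [size D] ensures that [C] really has an entry in that row,
    rather than the default 0. *)
Lemma col_le_raise (i : nat) (C1 C2 D : seq nat) :
  sorted ltn (C1 ++ i :: C2) -> sorted ltn D -> size D <= size (C1 ++ i :: C2) ->
  i.+1 \notin C1 ++ i :: C2 -> (i \in D -> i.+1 \in D) ->
  col_le (C1 ++ i :: C2) D -> col_le (C1 ++ i.+1 :: C2) D.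
Proof.
move=> srtC srtD sz notC inD /col_leP le_CD; apply/col_leP => k lt_k.
rewrite (nth_replace _ _ i); case: eqP => [ek|_]; last exact: le_CD.
have Ck : nth 0 (C1 ++ i :: C2) k = i by rewrite ek nth_cat ltnn subnn.
have := le_CD k lt_k; rewrite Ck leq_eqVlt => /orP[/eqP Dk|//].
have hD : i.+1 \in D by apply: inD; rewrite Dk mem_nth.
have lt_s : index i.+1 D < size D by rewrite index_mem.
have ks : k < index i.+1 D by rewrite -(sorted_nth_lt srtD) // -Dk nth_index.
have := le_CD _ lt_s; rewrite nth_index // leq_eqVlt ltnS => /orP[/eqP e|].
  by move: notC; rewrite -e mem_nth // (leq_trans lt_s).
have := sorted_nth_lt srtC (leq_trans lt_k sz) (leq_trans lt_s sz).
by rewrite Ck ks ltnNge => /negbTE->.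
Qed.

(** Mirror image: an obstructing row has [i.+1] in both columns. Then [A] has [i] in a higher row,
    where [D] has an entry at least [i] and different from [i], against strictness of [D]. *)
Lemma col_le_lower (i : nat) (A D1 D2 : seq nat) :
  sorted ltn A -> sorted ltn (D1 ++ i.+1 :: D2) ->
  i \notin D1 ++ i.+1 :: D2 -> (i.+1 \in A -> i \in A) ->
  col_le A (D1 ++ i.+1 :: D2) -> col_le A (D1 ++ i :: D2).
Proof.
move=> srtA srtD notD inA /col_leP le_AD; apply/col_leP => k.
have -> : size (D1 ++ i :: D2) = size (D1 ++ i.+1 :: D2) by rewrite !size_cat.
move=> lt_k; rewrite (nth_replace _ _ i.+1); case: eqP => [ek|_]; last exact: le_AD.
have Dk : nth 0 (D1 ++ i.+1 :: D2) k = i.+1 by rewrite ek nth_cat ltnn subnn.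
have := le_AD k lt_k; rewrite Dk leq_eqVlt ltnS => /orP[/eqP Ak|//].
(* Beyond the end of [A] the default 0 would be read, which is not [i.+1]. *)
have lt_kA : k < size A by rewrite ltnNge; apply/negP => /(nth_default 0); rewrite Ak.
have hA : i \in A by apply: inA; rewrite -Ak mem_nth.
have lt_s : index i A < size A by rewrite index_mem.
have sk : index i A < k by rewrite -(sorted_nth_lt srtA) // Ak nth_index.
have lt_sD := ltn_trans sk lt_k.
have := le_AD _ lt_sD; rewrite nth_index // leq_eqVlt => /orP[/eqP e|].
  by move: notD; rewrite [X in X \notin _]e mem_nth.
by move: sk; rewrite -(sorted_nth_lt srtD) // Dk ltnS => le1 /(leq_ltn_trans le1);
  rewrite ltnn.
Qed.

(** * Changing one letter of a semistandard tableau *)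

Lemma sorted_mid (x : nat) (C1 C2 : seq nat) :
  sorted ltn (C1 ++ x :: C2) =
  [&& sorted ltn (C1 ++ C2), all (gtn x) C1 & all (ltn x) C2].
Proof.
rewrite !(sorted_pairwise ltn_trans) !pairwise_cat allrel_consr /=.
apply/idP/idP.
  by case/andP => /andP[-> ->] /and3P[-> -> ->].
by case/and3P => /and3P[-> -> ->] -> ->.
Qed.

Lemma sorted_replace (x y : nat) (C1 C2 : seq nat) :
  x <= y.+1 -> y <= x.+1 -> y \notin C1 ++ C2 ->
  sorted ltn (C1 ++ x :: C2) -> sorted ltn (C1 ++ y :: C2).
Proof.
move=> xy yx; rewrite mem_cat negb_or => /andP[y1 y2].
rewrite !sorted_mid => /and3P[-> /allP lt1 /allP lt2] /=.
apply/andP; split; apply/allP => z hz.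
  have := lt1 z hz; have : z != y by apply: contraNneq y1 => <-.
  by rewrite /=; lia.
have := lt2 z hz; have : z != y by apply: contraNneq y2 => <-.
by rewrite /=; lia.
Qed.

Lemma sorted_cat_replace (X : Type) (e : rel X) (T1 T2 : seq X) (C C' : X) :
  sorted e (T1 ++ C :: T2) ->
  (forall T0 A, T1 = rcons T0 A -> e A C -> e A C') ->
  (forall D T3, T2 = D :: T3 -> e C D -> e C' D) -> sorted e (T1 ++ C' :: T2).
Proof.
rewrite !sorted_cat_cons => /andP[h1 h2] l r; apply/andP; split.
  case/lastP: T1 h1 l => [|T0 A] // + l; rewrite -!cats1 !(cats1 T0) !cat_rcons.
  by rewrite !sorted_cat_cons /= !andbT => /andP[-> /(l _ _ erefl)].
by case: T2 h2 r => //= D T3 /andP[h ->] /(_ _ _ erefl h) ->.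
Qed.

Lemma sorted_shape_SST (n : nat) (rho : seq nat) (T : filling) :
  T \in SST n rho -> sorted (fun C D : seq nat => size D <= size C) T.
Proof.
case/and4P=> /eqP shT _ _ _.
have : sorted geq (shape T).
  rewrite shT; apply: (homo_sorted (e := leq)) (iota_sorted _ _) => j k jk.
  by apply: sub_count => r /=; apply: leq_ltn_trans.
by rewrite /shape sorted_map.
Qed.

Lemma sorted_adjacent (X : Type) (e : rel X) (T1 T2 : seq X) (C D : X) :
  sorted e (T1 ++ C :: D :: T2) -> e C D.
Proof. by rewrite sorted_cat_cons => /andP[_ /andP[]]. Qed.

Lemma SST_replace (n : nat) (rho : seq nat) (T1 T2 : filling) (C1 C2 : seq nat) (x y : nat) :
  T1 ++ (C1 ++ x :: C2) :: T2 \in SST n rho -> 1 <= y <= n ->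
  sorted ltn (C1 ++ y :: C2) ->
  (forall T0 A, T1 = rcons T0 A -> sorted ltn A ->
    col_le A (C1 ++ x :: C2) -> col_le A (C1 ++ y :: C2)) ->
  (forall D T3, T2 = D :: T3 -> sorted ltn D -> size D <= size (C1 ++ x :: C2) ->
    col_le (C1 ++ x :: C2) D -> col_le (C1 ++ y :: C2) D) ->
  T1 ++ (C1 ++ y :: C2) :: T2 \in SST n rho.
Proof.
move=> hT hy srtC l r; have szT := sorted_shape_SST hT.
case/and4P: hT => shT; rewrite !all_cat /= all_cat /=.
case/and3P=> r1 /and3P[rC1 _ rC2] r2 /and3P[s1 sC s2] leT.
apply/and4P; split.
- by move: shT; rewrite /shape !map_cat /= !size_cat.
- by rewrite !all_cat /= all_cat /= r1 rC1 hy rC2 r2.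
- by rewrite all_cat /= s1 srtC s2.
apply: sorted_cat_replace leT _ _.
  by move=> T0 A eT; move: s1; rewrite eT all_rcons => /andP[sA _]; exact: l eT sA.
move=> D T3 eT; move: s2 szT; rewrite eT => /andP[sD _] szT.
exact: r eT sD (sorted_adjacent szT).
Qed.

(** * The AI condition and the complement of the first column *)

Lemma SST_AI_E (n : nat) (rho : seq nat) (T : filling) :
  (T \in SST_AI n rho) =
  (T \in SST n rho) && col_le (compl_col1 n T) (nth [::] T 1).
Proof.
rewrite inE; case: (boolP (T \in SST n rho)) => //= /and4P[/eqP <- _ _ _].
(* The shape identifies $d_2$ with the size of the second column; with fewer than two columns the
   defaults make both conditions vacuous. *)
by case: T => [|C [|D T]].
Qed.

(** Cut $1,\dots,n$ into the letters below [i], the letters [i] and [i.+1], and those above. The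
    outer blocks are filtered alike for both columns, and of the two middle letters the complement
    keeps the one that the column lacks. *)
Lemma compl_col1_replace (n i : nat) (C1 C2 : seq nat) (T T' : filling) :
  1 <= i < n -> i \notin C1 ++ C2 -> i.+1 \notin C1 ++ C2 -> exists A1 A2,
  compl_col1 n ((C1 ++ i :: C2) :: T) = A1 ++ i.+1 :: A2 /\
  compl_col1 n ((C1 ++ i.+1 :: C2) :: T') = A1 ++ i :: A2.
Proof.
move=> /andP[i_gt0 lt_in] ni nSi.
rewrite /compl_col1 /=; have -> : n = i.-1 + (n - i.-1) by lia.
rewrite iotaD; have -> : n - i.-1 = (n - i.+1).+2 by lia.
have -> : 1 + i.-1 = i by lia.
rewrite !filter_cat /=.
have mem x : (x \in C1 ++ i :: C2) = (x == i) || (x \in C1 ++ C2).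
  by rewrite !mem_cat inE orbCA.
have memS x : (x \in C1 ++ i.+1 :: C2) = (x == i.+1) || (x \in C1 ++ C2).
  by rewrite !mem_cat inE orbCA.
rewrite !mem !memS !eqxx (negbTE ni) (negbTE nSi) (gtn_eqF (ltnSn i)) (ltn_eqF (ltnSn i)) /=.
exists [seq x <- iota 1 i.-1 | x \notin C1 ++ i :: C2].
exists [seq x <- iota i.+2 (n - i.+1) | x \notin C1 ++ i :: C2].
split=> //; congr (_ ++ _ :: _); apply: eq_in_filter => x; rewrite mem_iota mem memS.
  case/andP=> _; rewrite add1n (prednK i_gt0) => lt_xi.
  by rewrite !ltn_eqF // ltnW.
by case/andP=> gt_x _; rewrite !gtn_eqF // ltnW.
Qed.

(** Together with the bound on the first column, this makes the complement tall enough to be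
    compared with the second column. *)
Lemma size_compl_col1 (n : nat) (C : seq nat) (T : filling) :
  n - size C <= size (compl_col1 n (C :: T)).
Proof.
rewrite /compl_col1 /= size_filter.
have := count_predC (mem C) (iota 1 n); rewrite size_iota.
have : count (mem C) (iota 1 n) <= size C.
  rewrite -size_filter uniq_leq_size ?filter_uniq ?iota_uniq // => x.
  by rewrite mem_filter => /andP[].
have -> : count (predC (mem C)) (iota 1 n) = count (fun x => x \notin C) (iota 1 n) by [].
lia.
Qed.

Lemma size_col1 (n l : nat) (rho : seq nat) (C : seq nat) (T : filling) :
  rho \in Par l -> C :: T \in SST n rho -> size C <= l.
Proof.
case/and3P=> _ _ sz /and4P[/eqP shT _ _ _]; apply: leq_trans sz.
move: shT; rewrite /shape /col_lengths /=; case: (head 0 rho) => //= m [-> _].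
exact: count_size.
Qed.

Lemma sorted_compl_col1 (n : nat) (T : filling) : sorted ltn (compl_col1 n T).
Proof. by apply: sorted_filter; [exact: ltn_trans | exact: iota_ltn_sorted]. Qed.

Lemma mem_compl_col1 (n x : nat) (C : seq nat) (T : filling) :
  1 <= x <= n -> (x \in compl_col1 n (C :: T)) = (x \notin C).
Proof. by move=> hx; rewrite mem_filter mem_iota add1n ltnS hx andbT. Qed.

(** * Stability of the AI tableaux under the two operators *)

Lemma Ftilde_SST_AI (n i : nat) (rho : seq nat) (T T' : filling) :
  1 <= i < n -> T \in SST_AI n rho -> Ftilde i T = Some T' -> T' \in SST_AI n rho.
Proof.
move=> hi; have /andP[i_gt0 lt_in] := hi; rewrite !SST_AI_E /Ftilde => /andP[hT aiT].
case eF: (Fword _ _) => [w|] //= [<-].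
have [u [v [eT -> [bal1 bal2]]]] := FwordP eF.
have [T1 [C1 [C2 [T2 [eTT eu ev ->]]]]] := col_reading_split eT.
move: hT aiT {eF eT}; rewrite {}eTT => hT aiT.
have srtC : sorted ltn (C1 ++ i :: C2).
  by case/and4P: hT => _ _; rewrite all_cat /= => /and3P[].
have := srtC; rewrite sorted_mid => /and3P[_ /allP lt1 /allP lt2].
have nC2 : i \notin C2 by apply/negP => /lt2; rewrite /= ltnn.
have nC1 : i \notin C1 by apply/negP => /lt1; rewrite /= ltnn.
have nSC1 : i.+1 \notin C1 by apply/negP => /lt1 /=; rewrite ltnNge leqnSn.
(* The word [u] ends with [rev C2], which contains no [i]; by balance it contains no [i.+1]
   either. *)
have nSC2 : i.+1 \notin C2.
  have := bal1 _ _ eu; rewrite !count_rev (count_memPn nC2) leqn0.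
  by move/eqP/count_memPn.
(* The word [v] begins with [rev C1 ++ rev D], and [C1] contains neither letter, so balance compares
   the counts in [D] alone. *)
have inD D T3 : T2 = D :: T3 -> i \in D -> i.+1 \in D.
  move=> eT2; rewrite -!has_pred1 !has_count.
  have := bal2 (rev C1 ++ rev D) (col_reading T3); rewrite ev eT2 -catA => /(_ erefl).
  rewrite !count_cat !count_rev (count_memPn nC1) (count_memPn nSC1).
  by move=> h1 h2; apply: leq_trans h1.
apply/andP; split.
  apply: SST_replace hT _ _ _ _ => //.
  - by apply: sorted_replace srtC; rewrite ?mem_cat ?negb_or ?nSC1 // ltnW.
  - by move=> T0 A _ _; apply: col_le_incr_r.
  move=> D T3 eT2 srtD sz; apply: col_le_raise => //; last exact: inD eT2.
  by rewrite mem_cat inE !negb_or nSC1 nSC2 andbT /= gtn_eqF.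
(* If the first column changes, its complement is lowered; if the second changes, the right side of
   the AI condition is raised; any later change leaves the condition untouched. *)
case: T1 {hT eu bal1} aiT => [|A [|B T1]] /=; last by [].
  have [||A1 [A2 [-> ->]]] := @compl_col1_replace n i C1 C2 T2 T2 hi.
  - by rewrite mem_cat negb_or nC1.
  - by rewrite mem_cat negb_or nSC1.
  exact: col_le_decr_l.
exact: col_le_incr_r.
Qed.

Lemma Etilde_SST_AI (n i : nat) (rho : seq nat) (T T' : filling) :
  rho \in Par n./2 -> 1 <= i < n -> ~~ odd (phi i (col_reading T)) ->
  T \in SST_AI n rho -> Etilde i T = Some T' -> T' \in SST_AI n rho.
Proof.
move=> rho_par hi; have /andP[i_gt0 lt_in] := hi.
have i_le_n : 1 <= i <= n by rewrite i_gt0 ltnW.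
move=> even_phi; rewrite !SST_AI_E /Etilde => /andP[hT aiT].
case eE: (Eword _ _) => [w|] //= [<-].
have [u [v [eT -> [bal1 bal2] ephi]]] := EwordP eE.
have [T1 [C1 [C2 [T2 [eTT eu ev ->]]]]] := col_reading_split eT.
move: hT aiT ephi even_phi {eE eT}; rewrite {}eTT => hT aiT ephi even_phi.
have srtC : sorted ltn (C1 ++ i.+1 :: C2).
  by case/and4P: hT => _ _; rewrite all_cat /= => /and3P[].
have := srtC; rewrite sorted_mid => /and3P[_ /allP lt1 /allP lt2].
have nSC2 : i.+1 \notin C2 by apply/negP => /lt2; rewrite /= ltnn.
have nSC1 : i.+1 \notin C1 by apply/negP => /lt1; rewrite /= ltnn.
have nC2 : i \notin C2 by apply/negP => /lt2 /=; rewrite ltnNge leqnSn.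
have nC1 : i \notin C1.
  have := bal2 _ _ ev; rewrite !count_rev (count_memPn nSC1) leqn0.
  by move/eqP/count_memPn.
have nC : i \notin C1 ++ C2 by rewrite mem_cat negb_or nC1.
have nSC : i.+1 \notin C1 ++ C2 by rewrite mem_cat negb_or nSC1.
have niC : i \notin C1 ++ i.+1 :: C2.
  by rewrite mem_cat inE !negb_or nC1 nC2 andbT /= ltn_eqF.
have inD D T3 : T2 = D :: T3 -> i \in D -> i.+1 \in D.
  move=> eT2; rewrite -!has_pred1 !has_count.
  have := bal2 (rev C1 ++ rev D) (col_reading T3); rewrite ev eT2 -catA => /(_ erefl).
  rewrite !count_cat !count_rev (count_memPn nC1) (count_memPn nSC1).
  by move=> h1 h2; apply: leq_trans h1.
(* Now the suffix [rev A ++ rev C2] of [u] is used, where [C2] contains neither letter. *)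
have inA T0 A : T1 = rcons T0 A -> i.+1 \in A -> i \in A.
  move=> eT1; rewrite -!has_pred1 !has_count.
  have := bal1 (col_reading T0) (rev A ++ rev C2).
  rewrite eu eT1 /col_reading map_rcons flatten_rcons -catA => /(_ erefl).
  rewrite !count_cat !count_rev (count_memPn nC2) (count_memPn nSC2) !addn0.
  by move=> h1 h2; apply: leq_trans h1.
have hT' : T1 ++ (C1 ++ i :: C2) :: T2 \in SST n rho.
  apply: SST_replace hT i_le_n _ _ _.
  - by apply: sorted_replace srtC; rewrite // ltnW.
  - by move=> T0 A eT1 srtA; apply: col_le_lower => //; apply: inA eT1.
  by move=> D T3 _ _ _; apply: col_le_decr_l.
apply/andP; split=> //.
case: T1 hT hT' {inA} eu ephi even_phi aiT => [|A [|B T1]] //=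
  hT hT' eu ephi even_phi.
  case: T2 hT inD {hT' ev ephi even_phi} => [|D T2] //= hT /(_ _ _ erefl) inD.
  (* Lowering a letter of the first column raises one of its complement, which then plays the role
     of a left neighbour of [D]. *)
  have [A1 [A2 [eA' eA]]] := @compl_col1_replace n i C1 C2 (D :: T2) (D :: T2) hi nC nSC.
  rewrite eA eA'; apply: col_le_raise => //; rewrite -?eA ?sorted_compl_col1 //.
  - by case/and4P: hT => _ _ /and3P[].
  (* From $d_2\le d_1\le\lfloor n/2\rfloor$ follows $d_2\le n-d_1$. *)
  - apply: leq_trans (size_compl_col1 _ _ _).
    have := size_col1 rho_par hT.
    have := @sorted_adjacent _ _ [::] _ _ _ (sorted_shape_SST hT).
    by clear => /=; lia.
  rewrite mem_compl_col1 //.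
  by rewrite mem_cat inE eqxx orbT.
apply: col_le_lower => //; first exact: sorted_compl_col1.
rewrite !mem_compl_col1 //.
(* The second column changes, so [u] is [rev A ++ rev C2]. If [A] had [i] but not [i.+1], the weight
   of [u], which is [phi], would be 1, against its evenness. *)
apply: contra => iA; apply: contraNT even_phi => SiA.
have uA : uniq A.
  by apply: (sorted_uniq ltn_trans ltnn); case/and4P: hT => _ _ /and3P[].
move: ephi; rewrite eu /col_reading /= cats0 !count_cat !count_rev.
rewrite (count_memPn nC2) (count_memPn nSC2) (count_memPn SiA) (count_uniq_mem _ uA) iA.
by rewrite !addn0 => ->.
Qed.

Theorem proposition2p5p11 (n : nat) (rho : seq nat)
    (n_ge3 : 3 <= n) (rho_par : rho \in Par n./2) :
  AI_subcrystal n rho (SST_AI n rho).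
Proof.
split=> [T|T i hT hi T']; first by rewrite SST_AI_E => /andP[].
have {}hi : 1 <= i < n by lia.
rewrite /Btilde; case: ifP => [_|/negbT even_phi]; first exact: Ftilde_SST_AI hT.
exact: Etilde_SST_AI hT.
Qed.
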